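(* Let $X$ be a Euclidean space or a Lobachevsky space of dimension greater than $1$, and let $N > 2$. Let $U$ be a neighbourhood of $\Sigma_2(X) \subset \Sigma_N(X)$ in $(\Sigma_N(X),\alpha)$. Then: (i) the map $\mathrm{cheb} : (U,\alpha) \to X$ is not Lipschitz; (ii) if $X$ is a Euclidean space, the map $\mathrm{cheb} : (\Sigma_N(X),\alpha) \to X$ is not uniformly continuous.
   Context: A Euclidean space is a real inner product space (possibly infinite-dimensional) with its standard metric; a Lobachevsky space is a hyperbolic space (constant curvature $-1$) with its standard metric. Write $\rho$ for the metric, $xy = \rho(x,y)$ and $xZ = \inf\{xu : u \in Z\}$ for $x,y\in X$, $Z\subset X$. For a positive integer $N$, $\Sigma_N(X)$ is the set of all non-empty subsets of $X$ consisting of no more than $N$ points (its elements are called $N$-nets). $\alpha$ is the Hausdorff metric on $\Sigma_N(X)$: $\alpha(M,T) = \max\{\max\{xT : x\in M\}, \max\{tM : t\in T\}\}$. The Chebyshev radius of $M\in\Sigma_N(X)$ is $R(M) = \inf\{\sup\{yx : y\in M\} : x\in X\}$, and the Chebyshev center $\mathrm{cheb}(M)\in X$ is the (unique) point with $\sup\{x\,\mathrm{cheb}(M) : x\in M\} = R(M)$. A map $f:(X,\rho)\to(X_1,\rho_1)$ is Lipschitz if there is a constant $L\ge 0$ with $\rho_1(f(x),f(y))\le L\rho(x,y)$ for all $x,y$. *)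

(* Defs.v *)
From HB Require Import structures.
From mathcomp Require Import all_boot all_order all_algebra.
From mathcomp Require Import sesquilinear.
From mathcomp Require Import all_classical all_reals all_analysis.

Set Implicit Arguments.
Unset Strict Implicit.
Unset Printing Implicit Defensive.

Import Order.TTheory GRing.Theory Num.Theory.

Local Open Scope classical_set_scope.
Local Open Scope ring_scope.

(* Inner product spaces are lmodTypes over R with a form of type
   {dot V for idfun}: bilinear, symmetric and positive definite. Neither
   completeness nor finite dimension is assumed. *)

Definition dim_gt (R : realType) (V : lmodType R) (n : nat) : Prop :=
  exists e : 'I_n.+1 -> V,
    forall a : 'I_n.+1 -> R, \sum_i a i *: e i = 0 -> forall i, a i = 0.

Definition dot_dist (R : realType) (V : lmodType R) (dot : {dot V for idfun})
  (u v : V) : R := Num.sqrt (dot (u - v) (u - v)).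

Definition arcosh (R : realType) (x : R) : R := ln (x + Num.sqrt (x ^+ 2 - 1)).

(* The hyperboloid model of curvature -1: the upper sheet of the unit
   hyperboloid of R * V for the Lorentz form t * t' - <v, v'>. Its dimension
   as a hyperbolic space is the dimension of V. *)
Definition lorentz (R : realType) (V : lmodType R) (dot : {dot V for idfun})
  (p q : R * V) : R := p.1 * q.1 - dot p.2 q.2.

Definition hyperboloid (R : realType) (V : lmodType R)
  (dot : {dot V for idfun}) : set (R * V) :=
  [set p | 0 < p.1 /\ lorentz dot p p = 1].

Definition hyp_dist (R : realType) (V : lmodType R) (dot : {dot V for idfun})
  (p q : R * V) : R := arcosh (lorentz dot p q).

(* X is isometric to the subset A of T equipped with the distance d;
   injectivity of phi follows from mdist_positivity. *)
Definition isometric_to (R : realType) (X : metricType R) (T : Type)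
  (A : set T) (d : T -> T -> R) : Prop :=
  exists phi : X -> T,
    range phi = A /\ forall x y, mdist x y = d (phi x) (phi y).

Definition euclidean_space_dim_gt (R : realType) (n : nat) (X : metricType R)
  : Prop :=
  exists (V : lmodType R) (dot : {dot V for idfun}),
    dim_gt V n /\ isometric_to X [set: V] (dot_dist dot).

Definition lobachevsky_space_dim_gt (R : realType) (n : nat)
  (X : metricType R) : Prop :=
  exists (V : lmodType R) (dot : {dot V for idfun}),
    dim_gt V n /\ isometric_to X (hyperboloid dot) (hyp_dist dot).

Record net (X : Type) (N : nat) := Net {
  net_pts :> set X ;
  net_neq0 : net_pts !=set0 ;
  net_card : (net_pts #<= `I_N)%card }.

Lemma net_inj (X : Type) (N : nat) (M T : net X N) :
  net_pts M = net_pts T -> M = T.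
Proof.
case: M T => [M M0 MN] [T T0 TN] /= MT; subst T.
by congr Net; exact: Prop_irrelevance.
Qed.

HB.instance Definition _ (X : Type) (N : nat) := gen_eqMixin (net X N).
HB.instance Definition _ (X : Type) (N : nat) := gen_choiceMixin (net X N).

Definition dist_to (R : realType) (X : metricType R) (x : X) (Z : set X) : R :=
  inf [set mdist x u | u in Z].

(* On nets the suprema range over finite non-empty sets, hence are maxima. *)
Definition hausdorff_dist (R : realType) (X : metricType R) (M T : set X) : R :=
  Num.max (sup [set dist_to x T | x in M]) (sup [set dist_to t M | t in T]).

Section HausdorffMetric.
Context {R : realType} {X : metricType R} {N : nat}.
Implicit Types (x y : X) (M T S : net X N).

Lemma finite_argmin (A : set X) (F : X -> R) :
  finite_set A -> A !=set0 -> exists2 a, A a & forall b, A b -> F a <= F b.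
Proof.
move=> /finite_seqP[s ->]; elim: s => [[x]|x s IHs _]; first by rewrite /= in_nil.
case: (s =P [::]) => [->|/eqP s0].
  by exists x => [|b] /=; rewrite ?mem_head// inE => /eqP ->.
have [|a sa aP] := IHs.
  by case: s s0 {IHs} => // y s _; exists y; rewrite /= mem_head.
have [xa|ax] := leP (F x) (F a).
  exists x => [|b] /=; first by rewrite mem_head.
  rewrite inE => /orP[/eqP -> //|sb].
  by rewrite (le_trans xa)// aP.
exists a => [|b] /=; first by rewrite inE; apply/orP; right.
by rewrite inE => /orP[/eqP ->|/aP //]; exact: ltW.
Qed.

Lemma net_finite M : finite_set M.
Proof. exact: card_le_finite (net_card M) (finite_II N). Qed.

Lemma dist_to_le x (Z : set X) u : Z u -> dist_to x Z <= mdist x u.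
Proof.
move=> Zu; apply: ge_inf; last by exists u.
by exists 0 => _ [v _ <-]; exact: mdist_ge0.
Qed.

Lemma dist_to_ge x (Z : set X) (a : R) : Z !=set0 ->
  (forall u, Z u -> a <= mdist x u) -> a <= dist_to x Z.
Proof.
move=> [u Zu] aZ; apply: lb_le_inf; first by exists (mdist x u), u.
by move=> _ [v Zv <-]; exact: aZ.
Qed.

Lemma dist_to_mem x (Z : set X) : Z x -> dist_to x Z = 0.
Proof.
move=> Zx; apply/le_anti/andP; split.
  by rewrite (le_trans (dist_to_le x Zx))// mdistxx.
by apply: dist_to_ge => [|u _]; [exists x | exact: mdist_ge0].
Qed.

Lemma sup_net_ub M (F : X -> R) x : net_pts M x -> F x <= sup [set F y | y in M].
Proof.
move=> Mx; apply: ub_le_sup; last by exists x.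
have [|a _ aP] := finite_argmin (fun y => - F y) (net_finite M).
  by exists x.
by exists (F a) => _ [y My <-]; rewrite -lerN2 aP.
Qed.

Lemma sup_net_le M (F : X -> R) (b : R) :
  (forall x, net_pts M x -> F x <= b) -> sup [set F y | y in M] <= b.
Proof.
move=> Fb; have [x Mx] := net_neq0 M.
apply: ge_sup; first by exists (F x), x.
by move=> _ [y My <-]; exact: Fb.
Qed.

Lemma hausdorff_dist_le M T (b : R) :
  (forall x, net_pts M x -> dist_to x T <= b) ->
  (forall t, net_pts T t -> dist_to t M <= b) ->
  hausdorff_dist M T <= b.
Proof. by move=> MTb TMb; rewrite ge_max !sup_net_le. Qed.

Lemma dist_to_hausdorff M T x : net_pts M x -> dist_to x T <= hausdorff_dist M T.
Proof.
by move=> Mx; rewrite le_max (sup_net_ub (fun y => dist_to y T) Mx).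
Qed.

Lemma hausdorff_dist_sym M T : hausdorff_dist M T = hausdorff_dist T M.
Proof. by rewrite /hausdorff_dist maxC. Qed.

Lemma hausdorff_distxx M : hausdorff_dist M M = 0.
Proof.
apply/le_anti/andP; split.
  by apply: hausdorff_dist_le => x Mx; rewrite dist_to_mem.
have [x Mx] := net_neq0 M.
by rewrite -[leLHS](dist_to_mem Mx) dist_to_hausdorff.
Qed.

Lemma hausdorff_dist_sub M T : hausdorff_dist M T = 0 -> M `<=` T.
Proof.
move=> MT0 x Mx.
have [t Tt tP] := finite_argmin (mdist x) (net_finite T) (net_neq0 T).
suff /mdist_positivity -> : mdist x t = 0 by [].
apply/le_anti; rewrite mdist_ge0 andbT -MT0.
by rewrite (le_trans (dist_to_ge (net_neq0 T) tP))// dist_to_hausdorff.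
Qed.

Lemma hausdorff_dist_positivity M T : hausdorff_dist M T = 0 -> M = T.
Proof.
move=> MT0; apply/net_inj/seteqP; split; apply: hausdorff_dist_sub => //.
by rewrite hausdorff_dist_sym.
Qed.

Lemma dist_to_triangle T M S x : net_pts M x ->
  dist_to x S <= hausdorff_dist M T + hausdorff_dist T S.
Proof.
move=> Mx; rewrite -lerBlDr; apply: le_trans (dist_to_hausdorff T Mx).
apply: dist_to_ge (net_neq0 T) _ => t Tt; rewrite lerBlDr.
apply: le_trans (lerD (lexx _) (dist_to_hausdorff S Tt)).
rewrite -lerBlDl; apply: dist_to_ge (net_neq0 S) _ => s Ss.
by rewrite lerBlDl (le_trans (dist_to_le x Ss))// metric_triangle.
Qed.

Lemma hausdorff_dist_triangle T M S :
  hausdorff_dist M S <= hausdorff_dist M T + hausdorff_dist T S.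
Proof.
apply: hausdorff_dist_le => [x Mx|s Ss]; first exact: dist_to_triangle.
rewrite (hausdorff_dist_sym M T) (hausdorff_dist_sym T S) addrC.
exact: dist_to_triangle.
Qed.

HB.instance Definition _ := @isMetric.Build R (net X N)
  (fun M T => hausdorff_dist M T) hausdorff_distxx hausdorff_dist_positivity
  hausdorff_dist_sym hausdorff_dist_triangle.

End HausdorffMetric.

Definition cheb_radius (R : realType) (X : metricType R) (M : set X) : R :=
  inf [set sup [set mdist y x | y in M] | x in [set: X]].

(* Centers exist and are unique for nets of Euclidean and Lobachevsky spaces.
   In a metric space where M has no center, the value is some point of M. *)
Definition cheb (R : realType) (X : metricType R) (N : nat) (M : net X N) : X :=
  xget (projT1 (cid (net_neq0 M)))
    [set c | sup [set mdist x c | x in (M : set X)] = cheb_radius M].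

Definition lipschitz_in (R : realType) (X Y : metricType R) (U : set X)
  (f : X -> Y) : Prop :=
  exists2 L : R, 0 <= L &
    forall x y, U x -> U y -> mdist (f x) (f y) <= L * mdist x y.

(* Main.v *)
Require Import Defs.
From mathcomp Require Import all_boot all_order all_algebra.
From mathcomp Require Import all_classical all_reals all_analysis.
From mathcomp Require Import sesquilinear ring lra.

Set Implicit Arguments.
Unset Strict Implicit.
Unset Printing Implicit Defensive.

Import Order.TTheory GRing.Theory Num.Theory.

Local Open Scope classical_set_scope.
Local Open Scope ring_scope.

(** The Chebyshev centre of a triangle jumps when an almost degenerate triangle
    changes its longest side. Let u and v be unit vectors with a small angle
    of order y between them, and consider the triangles
      M1 = {0, u, (u.v) v}   and   M2 = {0, (u.v) u, v}.
    The third vertex (u.v) v of M1 is the orthogonal projection of u on the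
    line of v, so it sees the segment [0, u] under a right angle and lies on the
    sphere with diameter [0, u]: the centre of M1 is the midpoint u / 2, and by
    symmetry that of M2 is v / 2. The centres are therefore at a distance of
    order y, while corresponding vertices of M1 and M2 are at distance
    1 - u.v, of order y^2. Both triangles tend to a two-point set as y tends
    to 0, so the centre is not Lipschitz near the two-point sets.

    In a Euclidean space this picture can be enlarged by the factor 1 / y: the
    centres stay at a distance of order 1 and the Hausdorff distance is still
    of order y, so the centre is not uniformly continuous.

    In a Lobachevsky space the same triangles are drawn in the Poincare ball.
    Hyperbolic balls are Euclidean balls there, and the hyperbolic ball with
    diameter [0, b] is the Euclidean ball with diameter [0, b]; only the
    hyperbolic midpoint of [0, b] is no longer b / 2. On a
    compact part of the ball the hyperbolic and Euclidean distances are
    bi-Lipschitz equivalent, so the orders of magnitude are unchanged.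

    The record [chart] collects what the argument needs from a map of V to X:
    [pinching] and [chart_not_lipschitz] run the argument in any chart, and
    [euclidean_chart] and [hyperbolic_chart] supply the two charts. [cheb_diametral]
    identifies the centre of a net lying in the ball on one of its diameters. *)

(** * Inner products *)

Section InnerProduct.
Context {R : realType} {V : lmodType R} (dot : {dot V for idfun}).
Implicit Types (u v w : V) (a : R).

Lemma dotC u v : dot u v = dot v u.
Proof. by rewrite (@hermitian_subproof _ _ _ _ dot u v) mul1r. Qed.

Lemma dotDl u v w : dot (u + v) w = dot u w + dot v w.
Proof. exact: linearDl. Qed.

Lemma dotZl a u w : dot (a *: u) w = a * dot u w.
Proof. exact: linearZl_LR. Qed.

Lemma dotNl u w : dot (- u) w = - dot u w.
Proof. exact: linearNl. Qed.

Lemma dot0l w : dot 0 w = 0.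
Proof. exact: linear0l. Qed.

Lemma dotDr u v w : dot w (u + v) = dot w u + dot w v.
Proof. by rewrite dotC dotDl !(dotC _ w). Qed.

Lemma dotZr a u w : dot w (a *: u) = a * dot w u.
Proof. by rewrite dotC dotZl dotC. Qed.

Lemma dotNr u w : dot w (- u) = - dot w u.
Proof. by rewrite dotC dotNl dotC. Qed.

Lemma dot0r w : dot w 0 = 0.
Proof. by rewrite dotC dot0l. Qed.

Definition dotE :=
  (dotDl, dotDr, dotNl, dotNr, dotZl, dotZr, dot0l, dot0r).

Lemma dot_gt0 u : u != 0 -> 0 < dot u u.
Proof. exact: neq0_dnorm_gt0. Qed.

Lemma dot_ge0 u : 0 <= dot u u.
Proof.
by have [->|/dot_gt0/ltW//] := eqVneq u 0; rewrite dot0l.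
Qed.

Lemma dot_eq0 u : dot u u <= 0 -> u = 0.
Proof.
by move=> u0; apply/eqP; apply/negPn/negP => /dot_gt0; rewrite ltNge u0.
Qed.

Lemma cauchy_schwarz u v : dot u v ^+ 2 <= dot u u * dot v v.
Proof.
have [->|/dot_gt0 v0] := eqVneq v 0; first by rewrite !dotE expr0n mulr0.
have := dot_ge0 (dot v v *: u - dot u v *: v).
rewrite !dotE (dotC v u) => H.
have {H} : 0 <= dot v v * (dot u u * dot v v - dot u v ^+ 2) by lra.
by rewrite pmulr_rge0// subr_ge0.
Qed.

Lemma dot_distE u v :
  dot_dist dot u v = Num.sqrt (dot u u - 2 * dot u v + dot v v).
Proof. by rewrite /dot_dist !dotE (dotC v u); congr Num.sqrt; ring. Qed.

(** Gram-Schmidt for the two vectors provided by the dimension hypothesis. *)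
Lemma orthonormal_pair : dim_gt V 1 ->
  exists u v, [/\ dot u u = 1, dot v v = 1 & dot u v = 0].
Proof.
have unitize w : w != 0 ->
    dot ((Num.sqrt (dot w w))^-1 *: w) ((Num.sqrt (dot w w))^-1 *: w) = 1.
  move=> /dot_gt0 w0; rewrite !dotE mulrA -expr2 exprVn sqr_sqrtr ?ltW//.
  by rewrite mulVf// gt_eqF.
move=> [e eP].
have comb_eq0 a b : a *: e ord0 + b *: e ord_max = 0 -> a = 0 /\ b = 0.
  move=> ab0; have := eP (fun i => if i == ord0 then a else b).
  rewrite big_ord_recl big_ord1 /= (_ : lift ord0 ord0 = ord_max); last exact/val_inj.
  by move=> /(_ ab0) H; split; [apply: (H ord0)|apply: (H ord_max)].
have e0 : e ord0 != 0.
  apply/eqP => e0; have [] := comb_eq0 1 0; last by move=> /eqP; rewrite oner_eq0.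
  by rewrite e0 scaler0 scale0r addr0.
set c := dot (e ord_max) (e ord0) / dot (e ord0) (e ord0).
have f0 : e ord_max - c *: e ord0 != 0.
  apply/eqP => f0; have [] := comb_eq0 (- c) 1; last by move=> _ /eqP; rewrite oner_eq0.
  by rewrite scale1r scaleNr addrC.
exists ((Num.sqrt (dot (e ord0) (e ord0)))^-1 *: e ord0).
set f := _ - _ in f0.
exists ((Num.sqrt (dot f f))^-1 *: f); split; [exact: unitize..|].
rewrite dotZl dotZr /f !dotE (dotC (e ord0)) /c divfK ?subrr ?mulr0//.
by rewrite gt_eqF ?dot_gt0.
Qed.

End InnerProduct.

(** * Chebyshev centres of sets with a diametral pair *)

Section DiametralPair.
Context {R : realType} {X : metricType R}.
Implicit Types (p q m x : X).

(** The second clause says that the closed balls about [p] and [q] through [m]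
    meet only in [m], which is how uniqueness of the midpoint is used. *)
Definition bisects p q m :=
  mdist q m = mdist p m /\
  forall x, mdist p x <= mdist p m -> mdist q x <= mdist p m -> x = m.

(** A ball containing [M] contains [p] and [q], so its radius is at least that
    of the ball about [m], and equality forces its centre to be [m]. *)
Lemma cheb_diametral (N : nat) (M : net X N) p q m :
  net_pts M p -> net_pts M q -> bisects p q m ->
  (forall x, net_pts M x -> mdist x m <= mdist p m) ->
  cheb M = m.
Proof.
move=> Mp Mq [qm uniq_m] Mm.
pose s c := sup [set mdist x c | x in (M : set X)].
have s_ub c x : net_pts M x -> mdist x c <= s c.
  by move=> Mx; apply: (sup_net_ub (fun y => mdist y c)).
have sm : s m = mdist p m.
  by apply/le_anti; rewrite s_ub// andbT; apply: sup_net_le.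
have s_uniq c : s c <= s m -> c = m.
  rewrite sm => scm; apply: uniq_m; apply: le_trans scm; exact: s_ub.
have rad : cheb_radius M = s m.
  apply/le_anti/andP; split.
    apply: ge_inf; last by exists m.
    exists 0 => _ [c _ <-]; exact: le_trans (mdist_ge0 _ _) (s_ub c p Mp).
  apply: lb_le_inf; first by exists (s m), m.
  move=> _ [c _ <-]; rewrite -/(s c); case: (leP (s m) (s c)) => // scm.
  by move: (scm); rewrite (s_uniq c (ltW scm)) ltxx.
rewrite /cheb; apply: xget_subset1; first by rewrite rad.
have center_eq c : s c = cheb_radius M -> c = m.
  by move=> sc; apply: s_uniq; rewrite sc rad.
by move=> c d /center_eq -> /center_eq ->.
Qed.

End DiametralPair.

Section ThreePointNets.
Context {R : realType} {X : metricType R} {N : nat}.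

Definition three_points (a b c : X) : set X :=
  [set nth a [:: a; b; c] i | i in `I_3].

Lemma three_pointsP a b c x :
  three_points a b c x <-> [\/ x = a, x = b | x = c].
Proof.
split=> [[[|[|[|//]]]] /= _ <-|[->|->|->]];
  [exact: Or31 | exact: Or32 | exact: Or33 | by exists 0 | by exists 1 | by exists 2].
Qed.

Hypothesis N_gt2 : (2 < N)%N.

Lemma three_points_neq0 a b c : three_points a b c !=set0.
Proof. by exists a; apply/three_pointsP; exact: Or31. Qed.

Lemma three_points_card a b c : (three_points a b c #<= `I_N)%card.
Proof. by apply: card_le_trans (card_image_le _ _) _; rewrite card_le_II. Qed.

Definition net3 a b c : net X N :=
  Net (three_points_neq0 a b c) (three_points_card a b c).

Lemma net3_card2 a b : (net_pts (net3 a b b) #<= `I_2)%card.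
Proof.
have -> : net_pts (net3 a b b) = [set nth a [:: a; b] i | i in `I_2].
  apply/seteqP; split=> [x /three_pointsP[->|->|->]|_ [[|[|//]] _ <-]];
    [by exists 0|by exists 1|by exists 1|..]; apply/three_pointsP => /=.
  exact: Or31.
exact: Or32.
exact: card_image_le.
Qed.

Lemma hausdorff_net3 a b c b' c' (d : R) :
  mdist b b' <= d -> mdist c c' <= d -> mdist (net3 a b c) (net3 a b' c') <= d.
Proof.
move=> bd cd.
have d0 : 0 <= d := le_trans (mdist_ge0 _ _) bd.
have in3 a1 b1 c1 x : [\/ x = a1, x = b1 | x = c1] -> net_pts (net3 a1 b1 c1) x.
  by move=> ?; apply/three_pointsP.
apply: hausdorff_dist_le => x /three_pointsP[]->.
- by rewrite dist_to_mem//; apply: in3; exact: Or31.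
- by apply: le_trans bd; apply/dist_to_le/in3; exact: Or32.
- by apply: le_trans cd; apply/dist_to_le/in3; exact: Or33.
- by rewrite dist_to_mem//; apply: in3; exact: Or31.
- by apply: le_trans bd; rewrite metric_sym; apply/dist_to_le/in3; exact: Or32.
- by apply: le_trans cd; rewrite metric_sym; apply/dist_to_le/in3; exact: Or33.
Qed.

End ThreePointNets.

(** * Pinched triangles in a chart *)

Section Chart.
Context {R : realType} {V : lmodType R} (dot : {dot V for idfun}).
Context {X : metricType R}.
Implicit Types (u v w z : V) (psi : V -> X).

(** A parametrization [psi] of part of X by the ball of radius [sigma] of V in
    which radial segments of length [sigma] behave as Euclidean diameters:
    [psi (rho *: u)] is the midpoint of [psi 0] and [psi (sigma *: u)], and
    [chart_ball] says that the Euclidean ball with diameter [0, sigma *: u],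
    whose equation is z.z <= sigma (z.u), is mapped into the metric ball about
    that midpoint. *)
Record chart psi (sigma rho k K : R) : Prop := Chart {
  chart_sigma : 0 < sigma ;
  chart_rho : 0 < rho <= sigma ;
  chart_k : 0 < k ;
  chart_K : 0 < K ;
  chart_lip : forall w z, dot w w <= sigma ^+ 2 -> dot z z <= sigma ^+ 2 ->
    k * dot_dist dot w z <= mdist (psi w) (psi z) <= K * dot_dist dot w z ;
  chart_mid : forall u, dot u u = 1 ->
    bisects (psi 0) (psi (sigma *: u)) (psi (rho *: u)) ;
  chart_ball : forall u z, dot u u = 1 -> dot z z <= sigma ^+ 2 ->
    dot z z <= sigma * dot z u ->
    mdist (psi z) (psi (rho *: u)) <= mdist (psi 0) (psi (rho *: u)) }.

Context {psi : V -> X} {sigma rho k K : R}.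
Hypothesis psiP : chart psi sigma rho k K.
Context {N : nat}.
Hypothesis N_gt2 : (2 < N)%N.

Lemma dot_dist_unit (s : R) u v : 0 <= s -> dot u u = 1 -> dot v v = 1 ->
  dot_dist dot (s *: u) (s *: v) = s * Num.sqrt (2 - 2 * dot u v).
Proof.
move=> s0 uu vv; rewrite dot_distE !dotE uu vv.
rewrite (_ : _ + _ = s ^+ 2 * (2 - 2 * dot u v)); last by ring.
by rewrite sqrtrM ?sqr_ge0// sqrtr_sqr ger0_norm.
Qed.

Lemma dot_dist_ray (s t : R) u : dot u u = 1 ->
  dot_dist dot (s *: u) (t *: u) = `|s - t|.
Proof.
move=> uu; rewrite dot_distE !dotE uu -sqrtr_sqr; congr Num.sqrt; ring.
Qed.

Lemma unit_dot_le1 u v : dot u u = 1 -> dot v v = 1 -> dot u v ^+ 2 <= 1.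
Proof.
by move=> uu vv; have := cauchy_schwarz dot u v; rewrite uu vv mulr1.
Qed.

Let sphere u : dot u u = 1 -> dot (sigma *: u) (sigma *: u) <= sigma ^+ 2.
Proof. by move=> uu; rewrite !dotE uu mulr1 expr2. Qed.

(* The projection of sigma *: u on the line of v stays in the domain. *)
Let foot u v : dot u u = 1 -> dot v v = 1 ->
  dot ((sigma * dot u v) *: v) ((sigma * dot u v) *: v) <= sigma ^+ 2.
Proof.
move=> uu vv; rewrite !dotE vv mulr1 -expr2 exprMn ler_piMr ?sqr_ge0//.
exact: unit_dot_le1.
Qed.

(** The triangle with a right angle at its third vertex, the foot of the
    perpendicular from [sigma *: u] on the line of [v]. *)
Definition pinched u v : net X N :=
  net3 N_gt2 (psi 0) (psi (sigma *: u)) (psi ((sigma * dot u v) *: v)).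

Lemma cheb_pinched u v : dot u u = 1 -> dot v v = 1 ->
  cheb (pinched u v) = psi (rho *: u).
Proof.
move=> uu vv; have mid := chart_mid psiP uu; apply: (cheb_diametral _ _ mid).
- by apply/three_pointsP; exact: Or31.
- by apply/three_pointsP; exact: Or32.
move=> x /three_pointsP[]->//; first by case: mid => ->.
apply: (chart_ball psiP) => //; first exact: foot.
by rewrite !dotE vv (dotC dot v u) le_eqVlt; apply/orP; left; apply/eqP; ring.
Qed.

Let foot_dist u v : dot u u = 1 -> dot v v = 1 ->
  mdist (psi (sigma *: v)) (psi ((sigma * dot u v) *: v))
    <= K * sigma * (1 - dot u v).
Proof.
move=> uu vv; have s0 := chart_sigma psiP.
have /andP[_] := chart_lip psiP (sphere vv) (foot uu vv).
move=> /le_trans; apply; rewrite -mulrA ler_pM2l ?(chart_K psiP)//.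
rewrite dot_dist_ray// -{1}(mulr1 sigma) -mulrBr normrM gtr0_norm//.
rewrite ger0_norm// subr_ge0.
have := unit_dot_le1 uu vv; nra.
Qed.

(** Exchanging [u] and [v] moves two vertices along their own rays by the
    fraction 1 - u.v, which is of second order in the angle. *)
Lemma pinched_dist u v : dot u u = 1 -> dot v v = 1 ->
  mdist (pinched u v) (pinched v u) <= K * sigma * (1 - dot u v).
Proof.
move=> uu vv.
(* As a set, so that the vertices on the same ray are matched. *)
have -> : pinched v u =
    net3 N_gt2 (psi 0) (psi ((sigma * dot u v) *: u)) (psi (sigma *: v)).
  apply/net_inj/seteqP; split=> x /three_pointsP xP; apply/three_pointsP;
    rewrite (dotC dot v u) in xP *; case: xP => ->;
    by [exact: Or31 | exact: Or32 | exact: Or33].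
apply: hausdorff_net3; last by rewrite metric_sym; exact: foot_dist.
by have := foot_dist vv uu; rewrite (dotC dot v u).
Qed.

(** When [u] and [v] tend to [w], the triangle tends to a two-point set that
    does not depend on them. *)
Lemma pinched_near_pair u v w : dot u u = 1 -> dot v v = 1 -> dot w w = 1 ->
  mdist (net3 N_gt2 (psi 0) (psi (sigma *: w)) (psi (sigma *: w)))
        (pinched u v)
    <= K * sigma * (Num.sqrt (2 - 2 * dot w u) + Num.sqrt (2 - 2 * dot w v)
                    + (1 - dot u v)).
Proof.
move=> uu vv ww; have s0 := ltW (chart_sigma psiP); have K0 := ltW (chart_K psiP).
have rim x : dot x x = 1 -> mdist (psi (sigma *: w)) (psi (sigma *: x))
    <= K * sigma * Num.sqrt (2 - 2 * dot w x).
  move=> xx; have /andP[_] := chart_lip psiP (sphere ww) (sphere xx).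
  by rewrite dot_dist_unit// mulrA.
have c1 : 0 <= 1 - dot u v by have := unit_dot_le1 uu vv; nra.
have Ks := mulr_ge0 K0 s0.
apply: hausdorff_net3.
  apply: le_trans (rim _ uu) _; apply: ler_wpM2l => //.
  by rewrite -[leRHS]addrA lerDl addr_ge0// sqrtr_ge0.
apply: le_trans (metric_triangle _ (psi (sigma *: v)) _) _.
rewrite mulrDr lerD ?foot_dist//; apply: le_trans (rim _ vv) _.
by apply: ler_wpM2l => //; rewrite lerDr sqrtr_ge0.
Qed.

(** The two centres lie on different rays, so their distance is of first order
    in the angle. *)
Lemma cheb_pinched_dist u v : dot u u = 1 -> dot v v = 1 ->
  k * rho * Num.sqrt (2 - 2 * dot u v)
    <= mdist (cheb (pinched u v)) (cheb (pinched v u)).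
Proof.
move=> uu vv; rewrite !cheb_pinched//.
have /andP[r0 rs] := chart_rho psiP.
have disc x : dot x x = 1 -> dot (rho *: x) (rho *: x) <= sigma ^+ 2.
  by move=> xx; rewrite !dotE xx mulr1 -expr2 lerXn2r// nnegrE ltW// (lt_le_trans r0).
have /andP[+ _] := chart_lip psiP (disc _ uu) (disc _ vv).
by rewrite dot_dist_unit ?(ltW r0)// mulrA.
Qed.

(** The directions are u, v = x e +- y f with x^2 + y^2 = 1, placed symmetrically
    about e: then 1 - u.v = 2 y^2, and the limit pair is [psi 0] with
    [psi (sigma *: e)] for every [y]. *)
Lemma pinching : dim_gt V 1 -> exists2 M0 : net X N,
  (net_pts M0 #<= `I_2)%card & forall y : R, 0 < y <= 1 ->
  exists M1 M2 : net X N,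
    [/\ mdist M0 M1 <= 6 * (K * sigma) * y, mdist M0 M2 <= 6 * (K * sigma) * y,
        mdist M1 M2 <= 2 * (K * sigma) * y ^+ 2 &
        2 * (k * rho) * y <= mdist (cheb M1) (cheb M2)].
Proof.
move=> /(orthonormal_pair dot)[e [f [ee ff ef]]].
exists (net3 N_gt2 (psi 0) (psi (sigma *: e)) (psi (sigma *: e))).
  exact: net3_card2.
move=> y /andP[y0 y1]; pose x := Num.sqrt (1 - y ^+ 2).
have y2 : y ^+ 2 <= 1 by rewrite expr_le1// ltW.
have x0 : 0 <= x by exact: sqrtr_ge0.
have xy : x ^+ 2 = 1 - y ^+ 2 by rewrite sqr_sqrtr// subr_ge0.
have unit (s : R) : s ^+ 2 = 1 -> dot (x *: e + (s * y) *: f) (x *: e + (s * y) *: f) = 1.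
  move=> s1; rewrite !dotE ee ff (dotC dot f) ef.
  by rewrite (_ : _ + _ = x ^+ 2 + s ^+ 2 * y ^+ 2); [rewrite xy s1; ring|ring].
pose u := x *: e + (1 * y) *: f; pose v := x *: e + (-1 * y) *: f.
have uu : dot u u = 1 by apply: unit; rewrite expr1n.
have vv : dot v v = 1 by apply: unit; rewrite sqrrN expr1n.
have eu : dot e u = x by rewrite /u !dotE ee ef; ring.
have ev : dot e v = x by rewrite /v !dotE ee ef; ring.
have uv : 1 - dot u v = 2 * y ^+ 2.
  rewrite /u /v !dotE ee ff (dotC dot f) ef.
  by rewrite (_ : _ - _ = 1 - x ^+ 2 + y ^+ 2); [rewrite xy; ring|ring].
have sqrt_le : Num.sqrt (2 - 2 * x) <= 2 * y.
  rewrite -(ler_pXn2r (n := 2)) ?nnegrE ?sqrtr_ge0//; last by nra.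
  have x1 : x <= 1 by nra.
  by rewrite sqr_sqrtr; nra.
have Ks : 0 < K * sigma by rewrite mulr_gt0 ?(chart_K psiP) ?(chart_sigma psiP).
have near_pair : K * sigma * (Num.sqrt (2 - 2 * x) + Num.sqrt (2 - 2 * x)
    + 2 * y ^+ 2) <= 6 * (K * sigma) * y.
  have -> : 6 * (K * sigma) * y = K * sigma * (6 * y) by ring.
  have yy : y ^+ 2 <= y by rewrite expr2 ler_piMr// ltW.
  by apply: ler_wpM2l; [exact: ltW|lra].
exists (pinched u v), (pinched v u); split.
- by apply: le_trans (pinched_near_pair uu vv ee) _; rewrite eu ev uv.
- by apply: le_trans (pinched_near_pair vv uu ee) _; rewrite eu ev (dotC dot v u) uv.
- by apply: le_trans (pinched_dist uu vv) _; rewrite uv; nra.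
- apply: le_trans (cheb_pinched_dist uu vv).
  rewrite (_ : 2 - 2 * dot u v = (2 * y) ^+ 2); last by rewrite exprMn; lra.
  by rewrite sqrtr_sqr ger0_norm; lra.
Qed.

(** The ratio of the two bounds in [pinching] is of order 1 / y. *)
Lemma chart_not_lipschitz (U : set (net X N)) : dim_gt V 1 ->
  set_nbhs [set M : net X N | (net_pts M #<= `I_2)%card] U ->
  ~ lipschitz_in U (@cheb R X N).
Proof.
move=> dimV U_nbhs [L L0 LU]; have [M0 M0_pair pinch] := pinching dimV.
have [e /= e0 eU] : nbhs_ball M0 U by rewrite -nbhs_ballP; exact: U_nbhs.
have Ks : 0 < K * sigma by rewrite mulr_gt0 ?(chart_K psiP) ?(chart_sigma psiP).
have kr : 0 < k * rho.
  by rewrite mulr_gt0 ?(chart_k psiP)//; case/andP: (chart_rho psiP).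
set A := 6 * (K * sigma) / e; set B := L * (K * sigma) / (k * rho).
have A0 : 0 <= A by apply: divr_ge0; lra.
have B0 : 0 <= B by apply: divr_ge0; [apply: mulr_ge0|]; lra.
have D0 : 0 < 1 + A + B by lra.
(* A y < 1 puts both triangles in the neighbourhood; B y < 1 beats L. *)
pose y := (1 + A + B)^-1.
have y0 : 0 < y by rewrite invr_gt0.
have yD : y * (1 + A + B) = 1 by rewrite mulVf// gt_eqF.
have y1 : y <= 1 by nra.
have Ay : 6 * (K * sigma) * y < e.
  have -> : 6 * (K * sigma) = A * e by rewrite divfK// gt_eqF.
  by rewrite mulrAC gtr_pMl//; nra.
have By : L * (K * sigma) * y < k * rho.
  have -> : L * (K * sigma) = B * (k * rho) by rewrite divfK// gt_eqF.
  by rewrite mulrAC gtr_pMl//; nra.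
have [|M1 [M2 [M01 M02 M12 c12]]] := pinch y; first by rewrite y0.
have := LU M1 M2 (eU _ _) (eU _ _); rewrite !ballEmdist /= => H.
have {}H := H (le_lt_trans M01 Ay) (le_lt_trans M02 Ay).
have := le_trans c12 (le_trans H (ler_wpM2l L0 M12)).
by apply/negP; rewrite -ltNge; nra.
Qed.

End Chart.

(** * Parametrizing a space by its model *)

(** [isometric_to] maps the abstract space to the model; charts go the other
    way, through a right inverse chosen on the model. *)
Lemma isometric_section {R : realType} {X : metricType R} {T : Type}
  (A : set T) (d : T -> T -> R) : A !=set0 -> isometric_to X A d ->
  exists2 g : T -> X,
    (forall s t, A s -> A t -> mdist (g s) (g t) = d s t) &
    forall x, exists2 t, A t & x = g t.
Proof.
move=> [t0 At0] [phi [phiA phid]].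
have lift t : A t -> exists x, phi x = t by rewrite -phiA => -[x _ <-]; exists x.
have [x0 _] := lift t0 At0.
have phig t : A t -> phi (xget x0 [set x | phi x = t]) = t.
  by move=> /lift; exact: (@xgetPex _ x0 [set x | phi x = t]).
exists (fun t => xget x0 [set x | phi x = t]) => [s t As At|x].
  by rewrite phid !phig.
have Ax : A (phi x) by rewrite -phiA; exists x.
exists (phi x) => //; apply: mdist_positivity.
by rewrite phid (phig _ Ax) -phid mdistxx.
Qed.

(** * Euclidean spaces *)

Section Euclidean.
Context {R : realType} {V : lmodType R} (dot : {dot V for idfun}).
Context {X : metricType R}.

(** The dilation factor [lambda] is free, and it is what [k] and [K] record;
    letting it grow is how uniform continuity is refuted. *)
Lemma euclidean_chart (g : V -> X) (lambda : R) : 0 < lambda ->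
  (forall v w, mdist (g v) (g w) = dot_dist dot v w) ->
  (forall x, exists v, x = g v) ->
  chart dot (fun v => g (lambda *: v)) 1 (1 / 2) lambda lambda.
Proof.
move=> l0 gd g_surj.
have gZ v w : mdist (g (lambda *: v)) (g (lambda *: w)) = lambda * dot_dist dot v w.
  rewrite gd !dot_distE !dotE (_ : _ + _ = lambda ^+ 2 *
    (dot v v - 2 * dot v w + dot w w)); last by ring.
  by rewrite sqrtrM ?sqr_ge0// sqrtr_sqr gtr0_norm.
split=> //.
- lra.
- by move=> w z _ _; rewrite gZ lexx.
- move=> u uu; split.
    by rewrite !gZ !dot_distE !dotE uu; congr (_ * Num.sqrt _); field.
  move=> x; have [v ->] := g_surj x.
  (* Work in the dilated coordinate, so that lambda cancels everywhere. *)
  rewrite (_ : v = lambda *: (lambda^-1 *: v)); last first.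
    by rewrite scalerA divff ?scale1r// gt_eqF.
  move: (lambda^-1 *: v) => {}v; rewrite !gZ !ler_pM2l//.
  rewrite !dot_distE !ler_sqrt; last 2 first.
  + by rewrite !dotE uu; lra.
  + by rewrite !dotE uu; lra.
  rewrite !dotE uu => v0 v1; congr (g (_ *: _)).
  apply/eqP; rewrite -subr_eq0; apply/eqP; apply: (@dot_eq0 _ _ dot).
  rewrite !dotE uu (dotC dot v u); lra.
- move=> u z uu _ zu; rewrite !gZ ler_pM2l// !dot_distE ler_sqrt.
    by rewrite !dotE uu; lra.
  by rewrite !dotE uu; lra.
Qed.

End Euclidean.

(** * Hyperbolic spaces *)

Section Arcosh.
Context {R : realType}.
Implicit Types x y : R.

Lemma arcosh1 : arcosh (1 : R) = 0.
Proof. by rewrite /arcosh expr1n subrr sqrtr0 addr0 ln1. Qed.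

Lemma ltr_arcosh x y : 1 <= x -> x < y -> arcosh x < arcosh y.
Proof.
move=> x1 xy; have sx := sqrtr_ge0 (x ^+ 2 - 1).
have sy := sqrtr_ge0 (y ^+ 2 - 1).
have sq : Num.sqrt (x ^+ 2 - 1) <= Num.sqrt (y ^+ 2 - 1).
  by apply: ler_wsqrtr; nra.
rewrite /arcosh ltr_ln ?posrE; lra.
Qed.

Lemma ler_arcosh x y : 1 <= x -> 1 <= y -> (arcosh x <= arcosh y) = (x <= y).
Proof.
move=> x1 y1; have [xy|yx|yx] := ltgtP x y.
- by rewrite ltW ?ltr_arcosh.
- by apply/negbTE; rewrite -ltNge ltr_arcosh.
- by rewrite yx lexx.
Qed.

(** Near 1, arcosh x behaves as sqrt (2 (x - 1)). Writing s = sqrt (x - 1) and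
    t = sqrt (x + 1), both bounds come from ln (1 + h) <= h, applied to x + s t
    and to its inverse x - s t. *)
Lemma arcosh_bounds x : 1 <= x <= 10 ->
  Num.sqrt (x - 1) / 4 <= arcosh x <= 7 * Num.sqrt (x - 1).
Proof.
move=> /andP[x1 x10].
pose s := Num.sqrt (x - 1); pose t := Num.sqrt (x + 1).
have s0 : 0 <= s := sqrtr_ge0 _; have t0 : 0 <= t := sqrtr_ge0 _.
have ss : s ^+ 2 = x - 1 by rewrite sqr_sqrtr; lra.
have tt : t ^+ 2 = x + 1 by rewrite sqr_sqrtr; lra.
have s3 : s <= 3 by nra.
have t4 : t <= 4 by nra.
have st : Num.sqrt (x ^+ 2 - 1) = s * t.
  rewrite -sqrtrM; last by lra.
  by congr Num.sqrt; ring.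
have st0 : 0 <= s * t by exact: mulr_ge0.
rewrite /arcosh st -/s; apply/andP; split.
  have inv : (x + s * t)^-1 = 1 + (x - s * t - 1).
    rewrite -[LHS]mul1r; apply: (canLR (mulfK _)); first by rewrite gt_eqF; lra.
    have : (s * t) ^+ 2 = x ^+ 2 - 1 by rewrite exprMn ss tt; ring.
    by lra.
  have : ln ((x + s * t)^-1) <= x - s * t - 1.
    rewrite inv le_ln1Dx//.
    have : 0 < (x + s * t)^-1 by rewrite invr_gt0; lra.
    by rewrite inv; lra.
  rewrite lnV ?posrE; last by lra.
  have gap : 1 / 4 <= t - s by nra.
  nra.
have -> : x + s * t = 1 + (x + s * t - 1) by ring.
apply: le_trans (le_ln1Dx _) _; nra.
Qed.

(** Here [D] is a squared Euclidean distance, [E] is the product of the factors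
    1 - z.z at its two ends, and 16 / 25 = 1 - (3 / 5)^2. *)
Lemma conformal_factor_bounds (D E : R) :
  0 <= D -> 16 / 25 * (16 / 25) <= E <= 1 ->
  D <= 2 * D / E <= (5 / 2) ^+ 2 * D.
Proof.
move=> D0 /andP[E0 E1]; have Epos : 0 < E by lra.
by rewrite ler_pdivlMr// ler_pdivrMr//; apply/andP; split; nra.
Qed.

End Arcosh.

Section Hyperboloid.
Context {R : realType} {V : lmodType R} (dot : {dot V for idfun}).
Implicit Types (p q m : R * V) (z w u : V).
Local Notation L := (lorentz dot).
Local Notation H := (hyperboloid dot).

(** The reversed Cauchy-Schwarz inequality, from t^2 t'^2 =
    (1 + v.v) (1 + v'.v') >= (1 + v.v')^2. *)
Lemma lorentz_ge1 p q : H p -> H q -> 1 <= L p q.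
Proof.
case: p q => [t v] [t' v'] [/= t0 tv] [/= t'0 tv'].
rewrite /lorentz /= in tv tv' *.
have CS := cauchy_schwarz dot v v'.
have := dot_ge0 dot (v - v'); rewrite !dotE (dotC dot v' v) => D.
have t2 : (t * t') ^+ 2 = (1 + dot v v) * (1 + dot v' v').
  have -> : 1 + dot v v = t * t by lra.
  have -> : 1 + dot v' v' = t' * t' by lra.
  by ring.
have tt0 : 0 < t * t' by exact: mulr_gt0.
have : (1 + dot v v') ^+ 2 <= (t * t') ^+ 2 by rewrite t2; lra.
nra.
Qed.

(** The Poincare ball parametrizes the hyperboloid by stereographic projection
    from (-1, 0). *)
Definition poincare z : R * V :=
  ((1 + dot z z) / (1 - dot z z), (2 / (1 - dot z z)) *: z).

Lemma poincare_hyperboloid z : dot z z < 1 -> H (poincare z).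
Proof.
move=> z1; have z0 := dot_ge0 dot z; split=> /=; first by rewrite divr_gt0; lra.
rewrite /lorentz /= !dotE; field; lra.
Qed.

(** Lorentz products depend on Euclidean distances and on a factor attached to
    each end: this is why the chart is conformal, and bi-Lipschitz on compact
    parts of the ball. *)
Lemma lorentz_poincare w z : dot w w < 1 -> dot z z < 1 ->
  L (poincare w) (poincare z) =
  1 + 2 * (dot w w - 2 * dot w z + dot z z) / ((1 - dot w w) * (1 - dot z z)).
Proof.
by move=> w1 z1; rewrite /lorentz /= !dotE; field; rewrite !lt0r_neq0//; lra.
Qed.

(** The point reflection in m maps p to 2 L(p,m) m - p. For p = poincare 0 and
    m = poincare (r *: u) this image is poincare (b *: u) with
    b = 2 r / (1 + r^2), the doubling formula of the hyperbolic tangent. *)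
Lemma poincare_mid (r : R) u q : dot u u = 1 -> 0 < r < 1 ->
  L (poincare 0) q + L (poincare ((2 * r / (1 + r ^+ 2)) *: u)) q =
  2 * L (poincare 0) (poincare (r *: u)) * L (poincare (r *: u)) q.
Proof.
move=> uu r01; have r2 : 0 < 1 - r ^+ 2 by nra.
have r3 : 0 < 1 + r ^+ 2 by nra.
have r4 : 0 < (1 + r ^+ 2) * (1 + r ^+ 2) - 2 * r * (2 * r).
  rewrite (_ : _ - _ = (1 - r ^+ 2) ^+ 2); last by ring.
  by rewrite exprn_gt0.
rewrite /lorentz /= !dotE uu; field.
by rewrite !lt0r_neq0// -expr2.
Qed.

Context {X : metricType R} {g : R * V -> X}.
Hypothesis g_dist : forall p q, H p -> H q -> mdist (g p) (g q) = hyp_dist dot p q.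
Hypothesis g_surj : forall x, exists2 p, H p & x = g p.

Lemma mdist_lorentz p q p' q' : H p -> H q -> H p' -> H q' ->
  (mdist (g p) (g q) <= mdist (g p') (g q')) = (L p q <= L p' q').
Proof.
by move=> *; rewrite !g_dist// ler_arcosh ?lorentz_ge1.
Qed.

(** The hypothesis says p + q = 2 L(p,m) m, tested against the hyperboloid. If
    [r] is no further than [m] from both [p] and [q], it gives L(m,r) <= 1,
    and 1 is attained only at [m]. *)
Lemma bisects_hyperboloid p q m : H p -> H q -> H m -> L q m = L p m ->
  (forall r, L p r + L q r = 2 * L p m * L m r) -> bisects (g p) (g q) (g m).
Proof.
move=> Hp Hq Hm qm mid; split; first by rewrite !g_dist// /hyp_dist qm.
move=> x; have [r Hr ->] := g_surj x => pr.
have -> : mdist (g p) (g m) = mdist (g q) (g m).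
  by rewrite !g_dist// /hyp_dist qm.
move: pr; rewrite !mdist_lorentz// qm => pr qr.
have mr1 : L m r = 1.
  have := lorentz_ge1 Hm Hr; have := lorentz_ge1 Hp Hm; have := mid r; nra.
by apply: mdist_positivity; rewrite metric_sym g_dist// /hyp_dist mr1 arcosh1.
Qed.

Lemma poincare_bilipschitz w z :
  dot w w <= (3 / 5) ^+ 2 -> dot z z <= (3 / 5) ^+ 2 ->
  1 / 4 * dot_dist dot w z <= mdist (g (poincare w)) (g (poincare z))
    <= 20 * dot_dist dot w z.
Proof.
move=> ww zz; have w0 := dot_ge0 dot w; have z0 := dot_ge0 dot z.
have Hw : H (poincare w) by apply: poincare_hyperboloid; lra.
have Hz : H (poincare z) by apply: poincare_hyperboloid; lra.
rewrite g_dist// /hyp_dist dot_distE.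
set D := dot w w - 2 * dot w z + dot z z.
have D0 : 0 <= D.
  by have := dot_ge0 dot (w - z); rewrite !dotE (dotC dot z w) /D; lra.
have D4 : D <= 36 / 25.
  by have := dot_ge0 dot (w + z); rewrite !dotE (dotC dot z w) /D; lra.
set a := L _ _.
have : a - 1 = 2 * D / ((1 - dot w w) * (1 - dot z z)).
  by rewrite /a lorentz_poincare; [rewrite -/D addrC addKr|lra|lra].
move=> aE.
have /andP[Da aD] : D <= a - 1 <= (5 / 2) ^+ 2 * D.
  rewrite aE; apply: conformal_factor_bounds => //; apply/andP; split; last first.
    by apply: mulr_ile1; lra.
  by apply: ler_pM; lra.
have /andP[lo hi] : Num.sqrt (a - 1) / 4 <= arcosh a <= 7 * Num.sqrt (a - 1).
  by apply: arcosh_bounds; lra.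
have sD : Num.sqrt D <= Num.sqrt (a - 1) by exact: ler_wsqrtr.
have sa : Num.sqrt (a - 1) <= 5 / 2 * Num.sqrt D.
  apply: le_trans (ler_wsqrtr aD) _.
  by rewrite sqrtrM ?sqr_ge0// sqrtr_sqr ger0_norm//; lra.
by have sD0 := sqrtr_ge0 D; apply/andP; split; lra.
Qed.

(** Any rho < 1 would do; rho = 1 / 3 makes sigma = 2 rho / (1 + rho^2) = 3 / 5
    rational and keeps the chart away from the boundary of the ball. *)
Lemma hyperbolic_chart : chart dot (g \o poincare) (3 / 5) (1 / 3) (1 / 4) 20.
Proof.
have Hball z : dot z z <= (3 / 5) ^+ 2 -> H (poincare z).
  by move=> zz; apply: poincare_hyperboloid; lra.
have Hr (r : R) u : dot u u = 1 -> 0 <= r <= 3 / 5 -> H (poincare (r *: u)).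
  by move=> uu r01; apply: Hball; rewrite !dotE uu; nra.
have H0 : H (poincare 0) by apply: Hball; rewrite dot0l; nra.
split; [lra|lra|lra|lra|exact: poincare_bilipschitz| |].
- move=> u uu; have s_eq : 2 * (1 / 3) / (1 + (1 / 3) ^+ 2) = 3 / 5 :> R by field.
  apply: bisects_hyperboloid => //; [apply: Hr => //; lra..| |].
    by rewrite !lorentz_poincare ?dotE ?uu; [field|lra..].
  by move=> p; rewrite -s_eq poincare_mid//; lra.
- move=> u z uu zz zu; have z0 := dot_ge0 dot z.
  have Hu : H (poincare ((1 / 3) *: u)) by apply: Hr => //; lra.
  rewrite /= mdist_lorentz //; last exact: Hball.
  rewrite !lorentz_poincare ?dotE ?uu; [|lra..].
  (* 1 / 4 = 2 rho^2 / (1 - rho^2) comes from the distance of 0 to the centre. *)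
  rewrite lerD2l; apply: (@le_trans _ _ (1 / 4)).
    by rewrite ler_pdivrMr; nra.
  by rewrite le_eqVlt; apply/orP; left; apply/eqP; field.
Qed.

End Hyperboloid.

(** * Failure of the Lipschitz condition and of uniform continuity *)

(** Dilating by 1 / y turns the bounds 2 y^2 and y of [pinching] into 2 y
    and 1. *)
Lemma euclidean_not_unif_continuous (R : realType) (V : lmodType R)
    (dot : {dot V for idfun}) (X : metricType R) (g : V -> X) (N : nat) :
  dim_gt V 1 -> (2 < N)%N ->
  (forall v w, mdist (g v) (g w) = dot_dist dot v w) ->
  (forall x, exists v, x = g v) ->
  ~ unif_continuous (@cheb R X N).
Proof.
move=> dimV N2 gd gs /unif_continuousP /(_ 1 ltr01)[d d0 dP].
have d20 : 0 < 2 / d by rewrite divr_gt0.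
have D0 : 0 < 1 + 2 / d by rewrite addr_gt0.
pose y := (1 + 2 / d)^-1.
have y0 : 0 < y by rewrite invr_gt0.
have y1 : y <= 1 by rewrite invf_le1// lerDl ltW.
have yd : 2 * y < d.
  by rewrite ltr_pdivrMr// mulrDr mulr1 mulrC divfK ?ltrDr// gt_eqF.
have yV0 : 0 < y^-1 by rewrite invr_gt0.
have [M0 _ pinch] := pinching (euclidean_chart yV0 gd gs) N2 dimV.
have [|M1 [M2 [_ _ M12 c12]]] := pinch y; first by rewrite y0.
have := dP (M1, M2); rewrite /= !ballEmdist /= => H.
have M12d : mdist M1 M2 < d.
  apply: le_lt_trans M12 _; rewrite (_ : _ * _ = 2 * y)//; field.
  exact: lt0r_neq0.
have := H M12d; apply/negP; rewrite -leNgt; apply: le_trans c12.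
rewrite (_ : _ * _ = 1)//; field; exact: lt0r_neq0.
Qed.

Theorem lemma3 (R : realType) (X : metricType R) (N : nat)
    (U : set (net X N)) :
  euclidean_space_dim_gt 1 X \/ lobachevsky_space_dim_gt 1 X ->
  (2 < N)%N ->
  set_nbhs [set M : net X N | ((M : set X) #<= `I_2)%card] U ->
  ~ lipschitz_in U (@cheb R X N) /\
  (euclidean_space_dim_gt 1 X -> ~ unif_continuous (@cheb R X N)).
Proof.
have euclid : euclidean_space_dim_gt 1 X -> exists (V : lmodType R)
    (dot : {dot V for idfun}) (g : V -> X),
    [/\ dim_gt V 1, forall v w, mdist (g v) (g w) = dot_dist dot v w &
        forall x, exists v, x = g v].
  move=> [V [dot [dimV iso]]].
  have [|g gd gs] := isometric_section _ iso; first by exists 0.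
  exists V, dot, g; split=> // [v w|x]; first exact: gd.
  by have [v _ ->] := gs x; exists v.
move=> space N2 nbhsU; split; last first.
  move=> /euclid[V [dot [g [dimV gd gs]]]].
  exact: euclidean_not_unif_continuous dimV N2 gd gs.
case: space => [/euclid[V [dot [g [dimV gd gs]]]]|[V [dot [dimV iso]]]].
  exact: (chart_not_lipschitz (euclidean_chart ltr01 gd gs)).
have [|g gd gs] := isometric_section _ iso.
  by exists (1, 0); split; rewrite /lorentz /= ?dot0l ?subr0 ?mulr1.
exact: (chart_not_lipschitz (hyperbolic_chart gd gs)).
Qed.
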